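(* Let $\mathcal{C}$ be a monoidal category with coequalizers in which every object is coflat and left robust. Let $R$ be a Frobenius separable algebra (i.e. both Frobenius and separable) and $i:R\to S$ an algebra extension in $\mathcal{C}$. Then $i:R\to S$ is Frobenius if and only if $S$ is a Frobenius algebra in $\mathcal{C}$ and, for some Frobenius pair $(\vartheta,e)$ for $R$ and some Frobenius pair $(\widetilde\vartheta,\widetilde e)$ for $S$, the following equality of morphisms $S\otimes R\to\underline{1}$ holds: $$\widetilde\vartheta\,m_S\,(\mathrm{Id}_S\otimes i)=\vartheta\,m_R\,\big(\mathrm{Id}_R\otimes\widetilde\vartheta\,m_S(i\otimes\mathrm{Id}_S)\otimes\mathrm{Id}_R\big)\,(e\otimes\mathrm{Id}_{S\otimes R}).$$
   Context: Monoidal categories are taken strict, with tensor product $\otimes$ and unit object $\underline{1}$; $m_A,\eta_A$ denote multiplication and unit of an algebra $A$. An object $X$ is coflat if $X\otimes-$ and $-\otimes X$ preserve coequalizers. For a right $R$-module $(X,\nu^R_X)$ and a left $R$-module $(Y,\mu^R_Y)$, $q^R_{X,Y}:X\otimes Y\to X\otimes_RY$ is the coequalizer of $\nu^R_X\otimes\mathrm{Id}_Y$ and $\mathrm{Id}_X\otimes\mu^R_Y$. For $g:X\to X'$ right $R$-linear, $\hat g$ is given by $\hat gq^R_{X,Y}=q^R_{X',Y}(g\otimes\mathrm{Id}_Y)$; for $f:Y\to Y'$ left $R$-linear, $\tilde f$ is given by $\tilde fq^R_{X,Y}=q^R_{X,Y'}(\mathrm{Id}_X\otimes f)$. The isomorphisms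 $\Upsilon_X:X\otimes_RR\to X$, $\Upsilon'_Y:R\otimes_RY\to Y$ are determined by $\Upsilon_Xq^R_{X,R}=\nu^R_X$, $\Upsilon'_Yq^R_{R,Y}=\mu^R_Y$. A left $R$-module $Y$ is left robust if for all objects $M$ and right $R$-modules $X$ the morphism $\theta'_{M,X,Y}:(M\otimes X)\otimes_RY\to M\otimes(X\otimes_RY)$ with $\theta'_{M,X,Y}q^R_{M\otimes X,Y}=\mathrm{Id}_M\otimes q^R_{X,Y}$ is an isomorphism; ''every object is left robust'' means this for every algebra $R$ and every left $R$-module. A Frobenius pair for an algebra $A$ is a pair $(\vartheta,e)$ with $\vartheta:A\to\underline{1}$, $e:\underline{1}\to A\otimes A$, $(m_A\otimes\mathrm{Id}_A)(\mathrm{Id}_A\otimes e)=(\mathrm{Id}_A\otimes m_A)(e\otimes\mathrm{Id}_A)$ and $(\vartheta\otimes\mathrm{Id}_A)e=\eta_A=(\mathrm{Id}_A\otimes\vartheta)e$; $A$ is Frobenius if it has a Frobenius pair. $A$ is separable if there is an $A$-bimodule morphism $\gamma:A\to A\otimes A$ with $m_A\gamma=\mathrm{Id}_A$. An algebra extension $i:R\to S$ is an algebra morphism; $S$ is an $R$-bimodule via $i$. $S\otimes_RS$ is an $S$-bimodule via $\mu^S_{S\otimes_RS}(\mathrm{Id}_S\otimes q^R_{S,S})=q^R_{S,S}(m_S\otimes\mathrm{Id}_S)$, $\nu^S_{S\otimes_RS}(q^R_{S,S}\otimes\mathrm{Id}_S)=q^R_{S,S}(\mathrm{Id}_S\otimes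 m_S)$. The extension $i$ is Frobenius if there are an $R$-bimodule morphism $\vartheta':S\to R$ and $e':\underline{1}\to S\otimes_RS$ in $\mathcal{C}$ with $\mu^S_{S\otimes_RS}(\mathrm{Id}_S\otimes e')=\nu^S_{S\otimes_RS}(e'\otimes\mathrm{Id}_S)$, $\widetilde{\vartheta'}e'=\Upsilon_S^{-1}\eta_S$, $\widehat{\vartheta'}e'=\Upsilon'^{-1}_S\eta_S$. *)

(* Defs.v *)
From Stdlib Require Import ClassicalEpsilon.

Set Implicit Arguments.
Unset Strict Implicit.
Unset Printing Implicit Defensive.

(* A strict monoidal category in the objects-and-arrows presentation: an object
   monoid and an arrow monoid with dom, cod and id.  Stating strictness this way
   needs no transport along equalities of objects.  Composition is a total
   function, but it is constrained only on composable pairs; its values on other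
   pairs are irrelevant, so typing is always stated explicitly, with
   [f ∈ X ⟶ Y]. *)
Record StrictMonoidalCategory := {
  ob : Type;
  mor : Type;
  dom : mor -> ob;
  cod : mor -> ob;
  idm : ob -> mor;
  comp : mor -> mor -> mor;
  dom_id : forall X, dom (idm X) = X;
  cod_id : forall X, cod (idm X) = X;
  dom_comp : forall g f, dom g = cod f -> dom (comp g f) = dom f;
  cod_comp : forall g f, dom g = cod f -> cod (comp g f) = cod g;
  comp_id_l : forall f, comp (idm (cod f)) f = f;
  comp_id_r : forall f, comp f (idm (dom f)) = f;
  comp_assoc : forall h g f, dom h = cod g -> dom g = cod f ->
    comp h (comp g f) = comp (comp h g) f;
  unit : ob;
  tenso : ob -> ob -> ob;
  tensm : mor -> mor -> mor;
  dom_tens : forall f g, dom (tensm f g) = tenso (dom f) (dom g);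
  cod_tens : forall f g, cod (tensm f g) = tenso (cod f) (cod g);
  tens_id : forall X Y, tensm (idm X) (idm Y) = idm (tenso X Y);
  tens_comp : forall g f g' f', dom g = cod f -> dom g' = cod f' ->
    tensm (comp g f) (comp g' f') = comp (tensm g g') (tensm f f');
  tenso_assoc : forall X Y Z, tenso X (tenso Y Z) = tenso (tenso X Y) Z;
  tenso_unit_l : forall X, tenso unit X = X;
  tenso_unit_r : forall X, tenso X unit = X;
  tensm_assoc : forall f g h, tensm f (tensm g h) = tensm (tensm f g) h;
  tensm_unit_l : forall f, tensm (idm unit) f = f;
  tensm_unit_r : forall f, tensm f (idm unit) = f
}.

Arguments dom {_} f.
Arguments cod {_} f.
Arguments idm {_} X.
Arguments comp {_} g f.
Arguments unit {_}.
Arguments tenso {_} X Y.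
Arguments tensm {_} f g.

Definition hom (C : StrictMonoidalCategory) (f : mor C) (X Y : ob C) : Prop :=
  dom f = X /\ cod f = Y.

Notation "𝟙" := unit.
Notation "'Id' X" := (idm X) (at level 10, X at level 9).
Notation "X ⊠ Y" := (tenso X Y) (at level 35, right associativity).
Notation "f ⊗ g" := (tensm f g) (at level 35, right associativity).
Notation "g ∘ f" := (comp g f) (at level 40, left associativity).
Notation "f ∈ X ⟶ Y" := (hom f X Y) (at level 70, X at level 69, Y at level 69).

Section Coequalizers.

Variable C : StrictMonoidalCategory.

Definition is_inverse (f g : mor C) : Prop :=
  g ∈ cod f ⟶ dom f /\ g ∘ f = Id (dom f) /\ f ∘ g = Id (cod f).

Definition is_iso (f : mor C) : Prop := exists g, is_inverse f g.

Definition inv (f : mor C) : mor C := epsilon (inhabits f) (is_inverse f).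

Definition parallel (f g : mor C) : Prop := dom f = dom g /\ cod f = cod g.

Definition is_coequalizer (f g q : mor C) : Prop :=
  parallel f g /\ dom q = cod f /\ q ∘ f = q ∘ g /\
  forall h, dom h = cod f -> h ∘ f = h ∘ g ->
    exists! k, k ∈ cod q ⟶ cod h /\ k ∘ q = h.

Definition has_coequalizers : Prop :=
  forall f g, parallel f g -> exists q, is_coequalizer f g q.

(* A chosen coequalizer of [f] and [g]. *)
Definition coeq (f g : mor C) : mor C :=
  epsilon (inhabits f) (is_coequalizer f g).

(* The morphism [k] determined by [k ∘ q = h], for [q] a coequalizer of a pair
   that [h] coequalizes. *)
Definition desc (q h : mor C) : mor C :=
  epsilon (inhabits h) (fun k => k ∈ cod q ⟶ cod h /\ k ∘ q = h).

Lemma inv_spec f : is_iso f -> is_inverse f (inv f).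
Proof. exact (epsilon_spec (inhabits f) (is_inverse f)). Qed.

Lemma coeq_spec f g :
  has_coequalizers -> parallel f g -> is_coequalizer f g (coeq f g).
Proof.
intros H p; exact (epsilon_spec (inhabits f) (is_coequalizer f g) (H f g p)).
Qed.

Lemma desc_spec f g q h :
  is_coequalizer f g q -> dom h = cod f -> h ∘ f = h ∘ g ->
  desc q h ∈ cod q ⟶ cod h /\ desc q h ∘ q = h.
Proof.
intros [_ [_ [_ U]]] d e; destruct (U h d e) as [k [Hk _]].
exact (epsilon_spec (inhabits h) (fun k => k ∈ cod q ⟶ cod h /\ k ∘ q = h)
  (ex_intro _ k Hk)).
Qed.

Definition coflat (X : ob C) : Prop :=
  forall f g q, is_coequalizer f g q ->
    is_coequalizer (Id X ⊗ f) (Id X ⊗ g) (Id X ⊗ q) /\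
    is_coequalizer (f ⊗ Id X) (g ⊗ Id X) (q ⊗ Id X).

End Coequalizers.

Record Algebra (C : StrictMonoidalCategory) := {
  car :> ob C;
  mul : mor C;
  one : mor C;
  mul_hom : mul ∈ car ⊠ car ⟶ car;
  one_hom : one ∈ 𝟙 ⟶ car;
  mul_assoc : mul ∘ (mul ⊗ Id car) = mul ∘ (Id car ⊗ mul);
  mul_one_l : mul ∘ (one ⊗ Id car) = Id car;
  mul_one_r : mul ∘ (Id car ⊗ one) = Id car
}.

Arguments mul {_} _.
Arguments one {_} _.
Notation "'m_' A" := (mul A) (at level 10, A at level 9).
Notation "'η_' A" := (one A) (at level 10, A at level 9).

Section Algebras.

Variable C : StrictMonoidalCategory.
Implicit Types R S A : Algebra C.

Definition algebra_morphism R S (i : mor C) : Prop :=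
  i ∈ R ⟶ S /\ i ∘ m_ R = m_ S ∘ (i ⊗ i) /\ i ∘ η_ R = η_ S.

Definition is_right_module R (X : ob C) (ν : mor C) : Prop :=
  ν ∈ X ⊠ R ⟶ X /\
  ν ∘ (ν ⊗ Id R) = ν ∘ (Id X ⊗ m_ R) /\ ν ∘ (Id X ⊗ η_ R) = Id X.

Definition is_left_module R (Y : ob C) (μ : mor C) : Prop :=
  μ ∈ R ⊠ Y ⟶ Y /\
  μ ∘ (Id R ⊗ μ) = μ ∘ (m_ R ⊗ Id Y) /\ μ ∘ (η_ R ⊗ Id Y) = Id Y.

(* [q X ν Y μ] is the canonical projection from [X ⊠ Y] to the tensor product
   over [R] of the right [R]-module [(X, ν)] and the left [R]-module [(Y, μ)];
   that tensor product is its codomain.  [R] enters through the actions only. *)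
Definition q (X : ob C) (ν : mor C) (Y : ob C) (μ : mor C) : mor C :=
  coeq (ν ⊗ Id Y) (Id X ⊗ μ).

Definition hat (X : ob C) (ν : mor C) (X' : ob C) (ν' : mor C)
    (Y : ob C) (μ : mor C) (g : mor C) : mor C :=
  desc (q X ν Y μ) (q X' ν' Y μ ∘ (g ⊗ Id Y)).

Definition tilde (X : ob C) (ν : mor C) (Y : ob C) (μ : mor C)
    (Y' : ob C) (μ' : mor C) (f : mor C) : mor C :=
  desc (q X ν Y μ) (q X ν Y' μ' ∘ (Id X ⊗ f)).

Definition Upsilon R (X : ob C) (ν : mor C) : mor C :=
  desc (q X ν R (m_ R)) ν.

Definition Upsilon' R (Y : ob C) (μ : mor C) : mor C :=
  desc (q R (m_ R) Y μ) μ.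

(* [M ⊠ X] carries the right action [Id M ⊗ ν]. *)
Definition theta' (M X : ob C) (ν : mor C) (Y : ob C) (μ : mor C) : mor C :=
  desc (q (M ⊠ X) (Id M ⊗ ν) Y μ) (Id M ⊗ q X ν Y μ).

Definition left_robust R (Y : ob C) (μ : mor C) : Prop :=
  forall (M X : ob C) (ν : mor C),
    is_right_module R X ν -> is_iso (theta' M X ν Y μ).

Definition frobenius_pair A (ϑ e : mor C) : Prop :=
  ϑ ∈ A ⟶ 𝟙 /\ e ∈ 𝟙 ⟶ A ⊠ A /\
  (m_ A ⊗ Id A) ∘ (Id A ⊗ e) = (Id A ⊗ m_ A) ∘ (e ⊗ Id A) /\
  (ϑ ⊗ Id A) ∘ e = η_ A /\ (Id A ⊗ ϑ) ∘ e = η_ A.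

Definition frobenius A : Prop := exists ϑ e, frobenius_pair A ϑ e.

(* [μ, ν] are the two [R]-actions on the source of [f], [μ', ν'] those on its
   target. *)
Definition bimodule_morphism R (X : ob C) (μ ν : mor C)
    (X' : ob C) (μ' ν' : mor C) (f : mor C) : Prop :=
  f ∈ X ⟶ X' /\ f ∘ μ = μ' ∘ (Id R ⊗ f) /\ f ∘ ν = ν' ∘ (f ⊗ Id R).

Definition separable A : Prop :=
  exists γ, bimodule_morphism A A (m_ A) (m_ A)
              (A ⊠ A) (m_ A ⊗ Id A) (Id A ⊗ m_ A) γ /\
            m_ A ∘ γ = Id A.

Section Extension.

Variables (R S : Algebra C) (i : mor C).

Definition res_left : mor C := m_ S ∘ (i ⊗ Id S).
Definition res_right : mor C := m_ S ∘ (Id S ⊗ i).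

Definition qSS : mor C := q S res_right S res_left.

Definition mu_SRS : mor C := desc (Id S ⊗ qSS) (qSS ∘ (m_ S ⊗ Id S)).
Definition nu_SRS : mor C := desc (qSS ⊗ Id S) (qSS ∘ (Id S ⊗ m_ S)).

Definition frobenius_extension : Prop :=
  exists ϑ' e' : mor C,
    bimodule_morphism R S res_left res_right R (m_ R) (m_ R) ϑ' /\
    e' ∈ 𝟙 ⟶ cod qSS /\
    mu_SRS ∘ (Id S ⊗ e') = nu_SRS ∘ (e' ⊗ Id S) /\
    tilde S res_right S res_left R (m_ R) ϑ' ∘ e' =
      inv (Upsilon R S res_right) ∘ η_ S /\
    hat S res_right R (m_ R) S res_left ϑ' ∘ e' =
      inv (Upsilon' R S res_left) ∘ η_ S.

End Extension.

End Algebras.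

(* Main.v *)
(** In Sweedler-style notation, let [e = e₁ ⊗ e₂] be the Casimir element of [R],
    so that [r e₁ ⊗ e₂ = e₁ ⊗ e₂ r] and [e₁ ϑ(e₂ x) = x].

    From an extension [(ϑ', e')] with [e' = s ⊗_R t] one gets the Frobenius pair
    [ϑt = ϑ ϑ'], [et = s i(e₁) ⊗ i(e₂) t] of [S]; the compatibility of the two
    forms expresses the [R]-linearity of [ϑ'] on both sides.

    Conversely, from a compatible pair [(ϑt, et)] put [ϑ'(s) = e₁ ϑt(i(e₂) s)].
    Separability of [R] provides an element [a] with [e₁ a e₂ = 1], and
    [e' = et₁ ⊗_R i(a) et₂] is the Casimir element of the extension.

    All these expressions are planar, so they make sense without a braiding. *)

From Stdlib Require Import List Arith Bool.
Require Import Defs.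
Import ListNotations.

Set Implicit Arguments.
Unset Strict Implicit.

(** * Category and tensor laws with explicit typing *)

Section HomRules.

Variable C : StrictMonoidalCategory.
Implicit Types (X Y Z : ob C) (f g h : mor C).

Lemma hom_id X : Id X ∈ X ⟶ X.
Proof. split; [apply dom_id | apply cod_id]. Qed.

Lemma hom_comp X Y Z f g : f ∈ X ⟶ Y -> g ∈ Y ⟶ Z -> g ∘ f ∈ X ⟶ Z.
Proof.
intros [<- e] [d <-]; split.
- apply dom_comp; congruence.
- apply cod_comp; congruence.
Qed.

Lemma hom_tens X Y X' Y' f g :
  f ∈ X ⟶ Y -> g ∈ X' ⟶ Y' -> f ⊗ g ∈ X ⊠ X' ⟶ Y ⊠ Y'.
Proof.
intros [<- <-] [<- <-]; split; [apply dom_tens | apply cod_tens].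
Qed.

Lemma id_l X Y f : f ∈ X ⟶ Y -> Id Y ∘ f = f.
Proof. intros [_ <-]; apply comp_id_l. Qed.

Lemma id_r X Y f : f ∈ X ⟶ Y -> f ∘ Id X = f.
Proof. intros [<- _]; apply comp_id_r. Qed.

Lemma hom_assoc X Y Z W f g h :
  f ∈ X ⟶ Y -> g ∈ Y ⟶ Z -> h ∈ Z ⟶ W -> h ∘ (g ∘ f) = h ∘ g ∘ f.
Proof. intros [_ a] [b c] [d _]; apply comp_assoc; congruence. Qed.

Lemma hom_tens_comp X Y Z X' Y' Z' f g f' g' :
  f ∈ X ⟶ Y -> g ∈ Y ⟶ Z -> f' ∈ X' ⟶ Y' -> g' ∈ Y' ⟶ Z' ->
  (g ∘ f) ⊗ (g' ∘ f') = (g ⊗ g') ∘ (f ⊗ f').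
Proof. intros [_ a] [b _] [_ c] [d _]; apply tens_comp; congruence. Qed.

Lemma interchange X Y X' Y' f g : f ∈ X ⟶ Y -> g ∈ X' ⟶ Y' ->
  (f ⊗ Id Y') ∘ (Id X ⊗ g) = (Id Y ⊗ g) ∘ (f ⊗ Id X').
Proof.
intros F G.
rewrite <- (hom_tens_comp (hom_id X) F G (hom_id Y')).
rewrite <- (hom_tens_comp F (hom_id Y) (hom_id X') G).
now rewrite (id_l F), (id_r F), (id_l G), (id_r G).
Qed.

End HomRules.

(** * String diagrams and a sound normal form for the interchange law *)

Section Diagrams.

Variable C : StrictMonoidalCategory.

Definition word := list nat.

Variable O : nat -> ob C.
Variables (M : nat -> mor C) (src tgt : nat -> word).

Fixpoint obw (w : word) : ob C :=
  match w with [] => 𝟙 | n :: w => O n ⊠ obw w end.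

Lemma obw_app u v : obw (u ++ v) = obw u ⊠ obw v.
Proof.
induction u as [|n u IH]; simpl; [now rewrite tenso_unit_l|].
now rewrite IH, tenso_assoc.
Qed.

(** Object expressions keep the bracketing of the goal; strictness lets [flat] forget bracketing and
    units, so that comparing objects becomes comparing words. *)
Inductive object := OUnit | OGen (n : nat) | OTens (X Y : object).

Fixpoint oeval (X : object) : ob C :=
  match X with
  | OUnit => 𝟙
  | OGen n => O n
  | OTens X Y => oeval X ⊠ oeval Y
  end.

Fixpoint flat (X : object) : word :=
  match X with
  | OUnit => []
  | OGen n => [n]
  | OTens X Y => flat X ++ flat Y
  end.

Lemma oeval_flat X : oeval X = obw (flat X).
Proof.
induction X as [|n|X IHX Y IHY]; simpl; [easy|now rewrite tenso_unit_r|].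
now rewrite obw_app, IHX, IHY.
Qed.

Hypothesis M_hom : forall n, M n ∈ obw (src n) ⟶ obw (tgt n).

Inductive term :=
| TGen (n : nat) | TId (X : object) | TComp (t u : term) | TTens (t u : term).

Fixpoint eval (t : term) : mor C :=
  match t with
  | TGen n => M n
  | TId X => Id (oeval X)
  | TComp t u => eval t ∘ eval u
  | TTens t u => eval t ⊗ eval u
  end.

(* A string diagram in general position, read from source to target; the slice
   [(l, n, r)] is the generator [n] with the wires [l] and [r] on its sides. *)
Definition slice : Type := word * nat * word.
Definition diagram : Type := list slice.

Definition slice_src (s : slice) : word := let '(l, n, r) := s in l ++ src n ++ r.
Definition slice_tgt (s : slice) : word := let '(l, n, r) := s in l ++ tgt n ++ r.
Definition slice_eval (s : slice) : mor C :=
  let '(l, n, r) := s in Id (obw l) ⊗ M n ⊗ Id (obw r).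

(** The source word is carried along because an empty diagram denotes an identity and does not
    itself say of which object. Composability is the separate relation [path]. *)
Fixpoint deval (a : word) (d : diagram) : mor C :=
  match d with
  | [] => Id (obw a)
  | s :: d => deval (slice_tgt s) d ∘ slice_eval s
  end.

Inductive path : word -> diagram -> word -> Prop :=
| path_nil a : path a [] a
| path_cons s d b : path (slice_tgt s) d b -> path (slice_src s) (s :: d) b.

Lemma slice_hom s : slice_eval s ∈ obw (slice_src s) ⟶ obw (slice_tgt s).
Proof.
destruct s as [[l n] r]; simpl; rewrite !obw_app.
repeat apply hom_tens; auto using hom_id.
Qed.

Lemma deval_hom a d b : path a d b -> deval a d ∈ obw a ⟶ obw b.
Proof.
induction 1 as [a|s d b _ IH]; simpl; [apply hom_id|].
exact (hom_comp (slice_hom s) IH).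
Qed.

Lemma deval_app a d b d' c : path a d b -> path b d' c ->
  path a (d ++ d') c /\ deval a (d ++ d') = deval b d' ∘ deval a d.
Proof.
intros P P'; induction P as [b|s d b P IH]; simpl.
- now rewrite (id_r (deval_hom P')).
- destruct (IH P') as [Q E]; split; [now constructor|].
  now rewrite E, (hom_assoc (slice_hom s) (deval_hom P) (deval_hom P')).
Qed.

Definition whisker (u v : word) : diagram -> diagram :=
  map (fun s : slice => let '(l, n, r) := s in (u ++ l, n, r ++ v)).

Lemma whisker_spec u v a d b : path a d b ->
  path (u ++ a ++ v) (whisker u v d) (u ++ b ++ v) /\
  deval (u ++ a ++ v) (whisker u v d) = Id (obw u) ⊗ deval a d ⊗ Id (obw v).
Proof.
induction 1 as [a|[[l n] r] d b P [Q E]]; simpl.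
- split; [constructor|].
  now rewrite !obw_app, !tens_id.
- pose (s := (u ++ l, n, r ++ v)).
  replace (u ++ (l ++ src n ++ r) ++ v) with (slice_src s)
    by (unfold s, slice_src; now rewrite <- !app_assoc).
  replace (u ++ slice_tgt (l, n, r) ++ v) with (slice_tgt s) in Q, E
    by (unfold s, slice_tgt; now rewrite <- !app_assoc).
  split; [exact (path_cons Q)|].
  change (deval (slice_tgt s) (whisker u v d) ∘ slice_eval s =
    Id (obw u) ⊗ (deval (slice_tgt (l, n, r)) d ∘ slice_eval (l, n, r)) ⊗ Id (obw v)).
  rewrite E; simpl in *.
  pose proof (slice_hom (l, n, r)) as H.
  pose proof (deval_hom P) as G.
  assert (J : Id (obw u) ⊗ (deval (l ++ tgt n ++ r) d ∘ (Id (obw l) ⊗ M n ⊗ Id (obw r)))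
       ⊗ Id (obw v) =
     (Id (obw u) ⊗ deval (l ++ tgt n ++ r) d ⊗ Id (obw v)) ∘
     (Id (obw u) ⊗ (Id (obw l) ⊗ M n ⊗ Id (obw r)) ⊗ Id (obw v))).
  { rewrite <- (hom_tens_comp (hom_id _) (hom_id _) (hom_tens H (hom_id _))
                 (hom_tens G (hom_id _))).
    rewrite <- (hom_tens_comp H G (hom_id _) (hom_id _)).
    now rewrite !(id_l (hom_id _)). }
  rewrite J; f_equal.
  now rewrite !obw_app, <- !tens_id, <- !tensm_assoc.
Qed.

Definition word_eqb (u v : word) : bool := if list_eq_dec Nat.eq_dec u v then true else false.

Lemma word_eqb_eq u v : word_eqb u v = true -> u = v.
Proof. unfold word_eqb; now destruct list_eq_dec. Qed.

(** General position forces an order on the two factors of a tensor: the left one comes first,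
    beside the source of the right one. [None] marks a composite whose middle words differ. *)
Fixpoint slices (t : term) : option (word * diagram * word) :=
  match t with
  | TGen n => Some (src n, [([], n, [])], tgt n)
  | TId X => Some (flat X, [], flat X)
  | TComp t u =>
    match slices t, slices u with
    | Some (b', d', c), Some (a, d, b) =>
      if word_eqb b b' then Some (a, d ++ d', c) else None
    | _, _ => None
    end
  | TTens t u =>
    match slices t, slices u with
    | Some (a, d, b), Some (a', d', b') =>
      Some (a ++ a', whisker [] a' d ++ whisker b [] d', b ++ b')
    | _, _ => None
    end
  end.

Lemma slices_spec t a d b : slices t = Some (a, d, b) ->
  path a d b /\ eval t = deval a d.
Proof.
revert a d b; induction t as [n|X|t IHt u IHu|t IHt u IHu]; simpl; intros a d b E.
- injection E as <- <- <-.
  pose proof (path_cons (s := ([], n, [])) (path_nil _)) as P.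
  simpl in *; rewrite !app_nil_r in *; split; [exact P|].
  now rewrite tensm_unit_l, tensm_unit_r, (id_l (M_hom n)).
- injection E as <- <- <-; now rewrite oeval_flat; split; [constructor|].
- destruct (slices t) as [[[b' d'] c]|]; [|discriminate].
  destruct (slices u) as [[[a0 d0] b0]|]; [|discriminate].
  destruct (word_eqb b0 b') eqn:B; [|discriminate]; injection E as <- <- <-.
  apply word_eqb_eq in B as ->.
  destruct (IHt _ _ _ eq_refl) as [Pt ->], (IHu _ _ _ eq_refl) as [Pu ->].
  now destruct (deval_app Pu Pt) as [P ->].
- destruct (slices t) as [[[a0 d0] b0]|]; [|discriminate].
  destruct (slices u) as [[[a' d'] b']|]; [|discriminate].
  injection E as <- <- <-.
  destruct (IHt _ _ _ eq_refl) as [Pt ->], (IHu _ _ _ eq_refl) as [Pu ->].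
  destruct (whisker_spec [] a' Pt) as [P1 E1], (whisker_spec b0 [] Pu) as [P2 E2].
  rewrite (app_nil_r a') in P2, E2; rewrite (app_nil_r b') in P2.
  cbn [app] in P1, E1.
  destruct (deval_app P1 P2) as [P ->]; split; [exact P|].
  rewrite E1, E2; simpl; rewrite tensm_unit_l, tensm_unit_r.
  pose proof (deval_hom Pt) as Ht; pose proof (deval_hom Pu) as Hu.
  (* Functoriality merges the two stages [Id ⊗ u] and [t ⊗ Id] into [t ⊗ u]. *)
  rewrite <- (hom_tens_comp Ht (hom_id _) (hom_id _) Hu).
  now rewrite (id_l Ht), (id_r Hu).
Qed.

(* Only moves to the left are performed: on connected diagrams they terminate
   and determine a normal form for the interchange law. *)
Definition swap (s s' : slice) : option (slice * slice) :=
  let '(l, n, r) := s in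
  let '(l', n', r') := s' in
  let x := skipn (length l' + length (src n')) l in
  if word_eqb l (l' ++ src n' ++ x) && word_eqb r' (x ++ tgt n ++ r)
  then Some ((l', n', x ++ src n ++ r), (l' ++ tgt n' ++ x, n, r))
  else None.

(** The word [x] consists of the wires between the two generators. Both orders agree by interchange
    of [M n'] with [Id (obw x) ⊗ M n], framed by the outer wires [l'] and [r]. *)
Lemma swap_spec s s' s1 s2 : swap s s' = Some (s1, s2) ->
  slice_src s1 = slice_src s /\ slice_src s2 = slice_tgt s1 /\
  slice_tgt s2 = slice_tgt s' /\
  slice_eval s2 ∘ slice_eval s1 = slice_eval s' ∘ slice_eval s.
Proof.
destruct s as [[l n] r], s' as [[l' n'] r']; simpl.
generalize (skipn (length l' + length (src n')) l); intros x.
destruct (word_eqb l (l' ++ src n' ++ x)) eqn:El; [|discriminate].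
destruct (word_eqb r' (x ++ tgt n ++ r)) eqn:Er; [|discriminate].
intros E; injection E as <- <-.
apply word_eqb_eq in El as ->; apply word_eqb_eq in Er as ->; simpl.
repeat split; [now rewrite <- ?app_assoc ..|].
set (X := Id (obw l')); set (Y := Id (obw x)); set (Z := Id (obw r)).
pose proof (interchange (M_hom n') (hom_tens (hom_id (obw x)) (M_hom n))) as I.
pose proof (hom_tens (hom_id (obw x)) (M_hom n)) as Hn.
pose proof (M_hom n') as Hn'.
assert (J : forall f g X1 X2 X3, f ∈ X1 ⟶ X2 -> g ∈ X2 ⟶ X3 ->
  (X ⊗ g ⊗ Z) ∘ (X ⊗ f ⊗ Z) = X ⊗ (g ∘ f) ⊗ Z).
{ intros f g X1 X2 X3 F G; unfold X, Z.
  rewrite <- (hom_tens_comp (hom_id _) (hom_id _) (hom_tens F (hom_id _))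
                 (hom_tens G (hom_id _))).
  rewrite <- (hom_tens_comp F G (hom_id _) (hom_id _)).
  now rewrite !(id_l (hom_id _)). }
pose proof (J _ _ _ _ _ (hom_tens (hom_id _) Hn) (hom_tens Hn' (hom_id _))) as J1.
pose proof (J _ _ _ _ _ (hom_tens Hn' (hom_id _)) (hom_tens (hom_id _) Hn)) as J2.
rewrite I, <- J2 in J1; clear J J2 I.
unfold X, Y, Z in *.
rewrite !obw_app, <- !tens_id, <- !tensm_assoc in *; symmetry; exact J1.
Qed.

(** One sweep of bubble sort: the slice [s] is carried along until a slice blocks it, and the
    blocking slice is carried from there on. *)
Fixpoint pass (s : slice) (d : diagram) : diagram :=
  match d with
  | [] => [s]
  | s' :: d =>
    match swap s s' with
    | Some (s1, s2) => s1 :: pass s2 d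
    | None => s :: pass s' d
    end
  end.

Definition bubble (d : diagram) : diagram :=
  match d with [] => [] | s :: d => pass s d end.

Lemma path_inv a s d b : path a (s :: d) b ->
  a = slice_src s /\ path (slice_tgt s) d b.
Proof. now inversion 1. Qed.

Lemma pass_spec s d b : path (slice_tgt s) d b ->
  path (slice_src s) (pass s d) b /\
  deval (slice_src s) (pass s d) = deval (slice_tgt s) d ∘ slice_eval s.
Proof.
revert s; induction d as [|s' d IH]; simpl; intros s P.
- now split; [constructor|].
- destruct (path_inv P) as [E P'].
  destruct (swap s s') as [[s1 s2]|] eqn:W.
  + destruct (swap_spec W) as (E1 & E2 & E3 & E4).
    rewrite <- E3 in P'; destruct (IH s2 P') as [Q F]; rewrite E2 in Q, F.
    rewrite <- E1; split; [now constructor|]; simpl.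
    pose proof (slice_hom s) as Hs; pose proof (slice_hom s') as Hs'.
    pose proof (slice_hom s1) as H1; pose proof (slice_hom s2) as H2.
    rewrite E2 in H2; rewrite E in Hs; pose proof (deval_hom P') as H.
    rewrite F, <- (hom_assoc H1 H2 H), E4, E3.
    rewrite E3 in H; now rewrite (hom_assoc Hs Hs' H).
  + destruct (IH s' P') as [Q F].
    split; [constructor; now rewrite E|]; simpl.
    now rewrite E, F.
Qed.

Lemma bubble_spec a d b : path a d b ->
  path a (bubble d) b /\ deval a (bubble d) = deval a d.
Proof.
destruct d as [|s d]; simpl; intros P; [now split|].
destruct (path_inv P) as [-> Q]; now apply pass_spec.
Qed.

Lemma iter_bubble_spec k a d b : path a d b ->
  path a (Nat.iter k bubble d) b /\ deval a (Nat.iter k bubble d) = deval a d.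
Proof.
intros P; induction k as [|k [Q E]]; simpl; [now split|].
destruct (bubble_spec Q) as [Q' E']; now rewrite E', E.
Qed.

(** Every number of sweeps preserves the value, so the quadratic budget affects only how many
    equalities are recognised, never soundness. *)
Definition normalize (t : term) : option (word * diagram) :=
  match slices t with
  | Some (a, d, _) => Some (a, Nat.iter (length d * length d) bubble d)
  | None => None
  end.

(** The condition [<> None] keeps two ill-typed terms from being identified. *)
Lemma normalize_sound t u : normalize t <> None -> normalize t = normalize u ->
  eval t = eval u.
Proof.
unfold normalize; destruct (slices t) as [[[a d] b]|] eqn:T; [|congruence].
destruct (slices u) as [[[a' d'] b']|] eqn:U; [|congruence].
intros _ E; injection E as <- E.
destruct (slices_spec T) as [P ->], (slices_spec U) as [Q ->].
destruct (iter_bubble_spec (length d * length d) P) as [_ <-].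
destruct (iter_bubble_spec (length d' * length d') Q) as [_ <-].
now rewrite E.
Qed.

Definition endpoints (t : term) : option (word * word) :=
  match slices t with Some (a, _, b) => Some (a, b) | None => None end.

Lemma endpoints_sound t X Y : endpoints t = Some (flat X, flat Y) ->
  eval t ∈ oeval X ⟶ oeval Y.
Proof.
unfold endpoints; destruct (slices t) as [[[a d] b]|] eqn:E; [|discriminate].
intros F; injection F as -> ->; destruct (slices_spec E) as [P ->].
rewrite !oeval_flat; now apply deval_hom.
Qed.

End Diagrams.

(** * Interpretation of diagrams in finite lists of objects and typed morphisms *)

Section Environment.

Variables (C : StrictMonoidalCategory) (os : list (ob C)).
Variable gs : list (mor C * object * object).

Definition env_ob (n : nat) : ob C := nth n os 𝟙.
Definition env_gen (n : nat) := nth n gs (Id 𝟙, OUnit, OUnit).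
Definition env_mor (n : nat) : mor C := let '(f, _, _) := env_gen n in f.
Definition env_src (n : nat) : word := let '(_, X, _) := env_gen n in flat X.
Definition env_tgt (n : nat) : word := let '(_, _, Y) := env_gen n in flat Y.

Definition well_typed (g : mor C * object * object) : Prop :=
  let '(f, X, Y) := g in f ∈ oeval env_ob X ⟶ oeval env_ob Y.

(** An index beyond the list denotes [Id 𝟙] with empty source and target, so typing holds for every
    [n] without a bound. *)
Lemma env_hom n : Forall well_typed gs ->
  env_mor n ∈ obw env_ob (env_src n) ⟶ obw env_ob (env_tgt n).
Proof.
intros H; unfold env_mor, env_src, env_tgt.
assert (G : well_typed (env_gen n)).
{ unfold env_gen; destruct (nth_in_or_default n gs (Id 𝟙, OUnit, OUnit)) as [I | ->].
  - exact (proj1 (Forall_forall _ _) H _ I).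
  - exact (hom_id _). }
destruct (env_gen n) as [[f X] Y]; simpl in G.
now rewrite <- !oeval_flat.
Qed.

Lemma diagram_eq (t u : term) : Forall well_typed gs ->
  normalize env_src env_tgt t <> None ->
  normalize env_src env_tgt t = normalize env_src env_tgt u ->
  eval env_ob env_mor t = eval env_ob env_mor u.
Proof. intros H; apply normalize_sound; intros n; exact (env_hom n H). Qed.

Lemma diagram_hom (t : term) (X Y : object) : Forall well_typed gs ->
  endpoints env_src env_tgt t = Some (flat X, flat Y) ->
  eval env_ob env_mor t ∈ oeval env_ob X ⟶ oeval env_ob Y.
Proof. intros H; apply endpoints_sound; intros n; exact (env_hom n H). Qed.

End Environment.

(** * Reification of goals into diagrams *)

Ltac insert x l :=
  lazymatch l with
  | context [x :: _] => l
  | _ => constr:(x :: l)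
  end.

Ltac position x l :=
  lazymatch l with
  | x :: _ => constr:(0)
  | _ :: ?l => let n := position x l in constr:(S n)
  end.

Ltac typing f :=
  lazymatch f with
  | mul ?A => constr:(mul_hom A)
  | one ?A => constr:(one_hom A)
  | _ => lazymatch goal with H : f ∈ _ ⟶ _ |- _ => constr:(H) end
  end.

Ltac objects X os :=
  lazymatch X with
  | unit => os
  | tenso ?X ?Y => let os := objects X os in objects Y os
  | _ => insert X os
  end.

Ltac reify_object os X :=
  lazymatch X with
  | unit => constr:(OUnit)
  | tenso ?X ?Y =>
    let x := reify_object os X in
    let y := reify_object os Y in constr:(OTens x y)
  | _ => let n := position X os in constr:(OGen n)
  end.

(** Whatever is not syntactically an identity, composite or tensor counts as an atomic generator;
    abbreviations therefore stay opaque until unfolded. *)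
Ltac generators t fs :=
  lazymatch t with
  | idm _ => fs
  | comp ?t ?u => let fs := generators t fs in generators u fs
  | tensm ?t ?u => let fs := generators t fs in generators u fs
  | _ => insert t fs
  end.

Ltac all_objects t os :=
  lazymatch t with
  | idm ?X => objects X os
  | comp ?t ?u => let os := all_objects t os in all_objects u os
  | tensm ?t ?u => let os := all_objects t os in all_objects u os
  | _ =>
    let H := typing t in
    lazymatch type of H with
    | hom _ ?X ?Y => let os := objects X os in objects Y os
    end
  end.

Ltac reify os fs t :=
  lazymatch t with
  | idm ?X => let x := reify_object os X in constr:(TId x)
  | comp ?t ?u => let t := reify os fs t in let u := reify os fs u in constr:(TComp t u)
  | tensm ?t ?u => let t := reify os fs t in let u := reify os fs u in constr:(TTens t u)
  | _ => let n := position t fs in constr:(TGen n)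
  end.

Ltac signature os fs :=
  lazymatch fs with
  | @nil (mor ?C) => constr:(@nil (mor C * object * object))
  | ?f :: ?fs =>
    let gs := signature os fs in
    let H := typing f in
    lazymatch type of H with
    | hom _ ?X ?Y =>
      let x := reify_object os X in
      let y := reify_object os Y in constr:((f, x, y) :: gs)
    end
  end.

Ltac well_typedness C os gs :=
  lazymatch gs with
  | nil => constr:(Forall_nil (@well_typed C os))
  | (?f, ?x, ?y) :: ?gs =>
    let H := typing f in
    let G := well_typedness C os gs in
    constr:(@Forall_cons _ (@well_typed C os) (f, x, y) gs H G)
  end.

(* Equality up to the interchange law; the types of variables are looked up
   among the hypotheses [f ∈ X ⟶ Y]. *)
Ltac diag :=
  lazymatch goal with
  | |- @eq (mor ?C) ?t ?u =>
    let fs := generators t (@nil (mor C)) in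
    let fs := generators u fs in
    let os := all_objects t (@nil (ob C)) in
    let os := all_objects u os in
    let gs := signature os fs in
    let t' := reify os fs t in
    let u' := reify os fs u in
    let H := well_typedness C os gs in
    refine (@diagram_eq C os gs t' u' H _ _);
    [vm_compute; discriminate | vm_compute; reflexivity]
  end.

Ltac typed :=
  lazymatch goal with
  | |- @hom ?C ?t ?X ?Y =>
    let fs := generators t (@nil (mor C)) in
    let os := all_objects t (@nil (ob C)) in
    let os := objects X os in
    let os := objects Y os in
    let gs := signature os fs in
    let t' := reify os fs t in
    let x := reify_object os X in
    let y := reify_object os Y in
    let H := well_typedness C os gs in
    refine (@diagram_hom C os gs t' x y H _);
    vm_compute; reflexivity
  end.

(** Redraws the left-hand side up to interchange, so that the next rewrite finds its redex as a
    literal subterm. *)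
Ltac string t := transitivity t; [diag|].

(** * Snake identities, and the element supplied by separability *)

Section FrobeniusPair.

Variables (C : StrictMonoidalCategory) (A : Algebra C) (ϑ e : mor C).
Hypothesis Hpair : frobenius_pair A ϑ e.

(** Centrality of [e] moves the argument to the first leg, which leaves [ϑ] alone on the second leg,
    where the counit law applies. *)
Lemma frobenius_snake_r : (Id A ⊗ (ϑ ∘ m_ A)) ∘ (e ⊗ Id A) = Id A.
Proof.
destruct Hpair as (Hϑ & He & central & _ & counit).
string ((Id A ⊗ ϑ) ∘ ((Id A ⊗ m_ A) ∘ (e ⊗ Id A))); rewrite <- central.
string (m_ A ∘ (Id A ⊗ ((Id A ⊗ ϑ) ∘ e))); rewrite counit.
apply mul_one_r.
Qed.

Lemma frobenius_snake_l : ((ϑ ∘ m_ A) ⊗ Id A) ∘ (Id A ⊗ e) = Id A.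
Proof.
destruct Hpair as (Hϑ & He & central & counit & _).
string ((ϑ ⊗ Id A) ∘ ((m_ A ⊗ Id A) ∘ (Id A ⊗ e))); rewrite central.
string (m_ A ∘ (((ϑ ⊗ Id A) ∘ e) ⊗ Id A)); rewrite counit.
apply mul_one_l.
Qed.

(** Write [γ(1) = x ⊗ y] and put [a = ϑ(x) y]. Centrality of [γ(1)] gives
    [e₁ ϑ(x) y e₂ = e₁ ϑ(e₂ x) y], which is [x y] by the snake identity, and [x y = 1] because [γ]
    splits the multiplication. *)
Lemma separable_frobenius_element : separable A ->
  exists a, a ∈ 𝟙 ⟶ A /\ m_ A ∘ (Id A ⊗ (m_ A ∘ (a ⊗ Id A))) ∘ e = η_ A.
Proof.
intros (γ & (Hγ & left & right) & split).
pose proof frobenius_snake_r as snake.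
destruct Hpair as (Hϑ & He & _ & _ & _).
(* Both sides equal [γ], by linearity on the left and on the right together with the unit laws. *)
assert (central : (m_ A ⊗ Id A) ∘ (Id A ⊗ (γ ∘ η_ A)) = (Id A ⊗ m_ A) ∘ ((γ ∘ η_ A) ⊗ Id A)).
{ string ((m_ A ⊗ Id A) ∘ (Id A ⊗ γ) ∘ (Id A ⊗ η_ A)); rewrite <- left.
  string (γ ∘ (m_ A ∘ (Id A ⊗ η_ A))); rewrite mul_one_r.
  transitivity (γ ∘ (m_ A ∘ (η_ A ⊗ Id A))); [now rewrite mul_one_l|].
  string (γ ∘ m_ A ∘ (η_ A ⊗ Id A)); rewrite right.
  diag. }
exists ((ϑ ⊗ Id A) ∘ γ ∘ η_ A); split.
- typed.
- string (m_ A ∘ (Id A ⊗ ϑ ⊗ Id A) ∘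
    (Id A ⊗ ((Id A ⊗ m_ A) ∘ ((γ ∘ η_ A) ⊗ Id A))) ∘ e).
  rewrite <- central.
  string (m_ A ∘ (((Id A ⊗ (ϑ ∘ m_ A)) ∘ (e ⊗ Id A)) ⊗ Id A) ∘ γ ∘ η_ A).
  rewrite snake.
  string (m_ A ∘ γ ∘ η_ A); rewrite split.
  diag.
Qed.

End FrobeniusPair.

(** * Element calculus for an extension of a Frobenius algebra *)

Section FrobeniusExtension.

Variables (C : StrictMonoidalCategory) (R S : Algebra C) (i : mor C).
Hypothesis i_hom : i ∈ R ⟶ S.
Hypothesis i_mul : i ∘ m_ R = m_ S ∘ (i ⊗ i).
Hypothesis i_one : i ∘ η_ R = η_ S.

Variables (ϑ e : mor C).
Hypothesis Rpair : frobenius_pair R ϑ e.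

Let ϑ_hom : ϑ ∈ R ⟶ 𝟙 := proj1 Rpair.
Let e_hom : e ∈ 𝟙 ⟶ R ⊠ R := proj1 (proj2 Rpair).

(** * From a compatible pair on [S] to the data of the extension *)

Section FromFrobeniusAlgebra.

Variables ϑt et : mor C.
Hypothesis Spair : frobenius_pair S ϑt et.
Hypothesis compat : ϑt ∘ m_ S ∘ (Id S ⊗ i) =
  ϑ ∘ m_ R ∘ (Id R ⊗ (ϑt ∘ m_ S ∘ (i ⊗ Id S)) ⊗ Id R) ∘ (e ⊗ Id (S ⊠ R)).

Let ϑt_hom : ϑt ∈ S ⟶ 𝟙 := proj1 Spair.
Let et_hom : et ∈ 𝟙 ⟶ S ⊠ S := proj1 (proj2 Spair).

Definition relative_form : mor C := (Id R ⊗ (ϑt ∘ m_ S ∘ (i ⊗ Id S))) ∘ (e ⊗ Id S).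

Let ϑ' := relative_form.

Lemma relative_form_hom : ϑ' ∈ S ⟶ R.
Proof.
unfold ϑ', relative_form; typed.
Qed.

(** [ϑ'(i(r) s) = e₁ ϑt(i(e₂ r) s) = r e₁ ϑt(i(e₂) s)], by centrality of [e]. *)
Lemma relative_form_left : ϑ' ∘ (m_ S ∘ (i ⊗ Id S)) = m_ R ∘ (Id R ⊗ ϑ').
Proof.
pose proof Rpair as (_ & _ & central & _); unfold ϑ', relative_form.
string ((Id R ⊗ ϑt) ∘ (Id R ⊗ (m_ S ∘ (Id S ⊗ m_ S))) ∘ (Id R ⊗ i ⊗ i ⊗ Id S) ∘
  (e ⊗ Id (R ⊠ S))); rewrite <- mul_assoc.
string ((Id R ⊗ (ϑt ∘ m_ S)) ∘ (Id R ⊗ (m_ S ∘ (i ⊗ i)) ⊗ Id S) ∘ (e ⊗ Id (R ⊠ S))).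
rewrite <- i_mul.
string ((Id R ⊗ (ϑt ∘ m_ S ∘ (i ⊗ Id S))) ∘ (((Id R ⊗ m_ R) ∘ (e ⊗ Id R)) ⊗ Id S)).
rewrite <- central; diag.
Qed.

Lemma relative_form_counit : ϑ ∘ ϑ' = ϑt.
Proof.
pose proof Rpair as (_ & _ & _ & counit & _); unfold ϑ', relative_form.
string (ϑt ∘ m_ S ∘ ((i ∘ ((ϑ ⊗ Id R) ∘ e)) ⊗ Id S)); rewrite counit, i_one.
string (ϑt ∘ (m_ S ∘ (η_ S ⊗ Id S))); rewrite mul_one_l; diag.
Qed.

(** The right-hand side of [compat] is [ϑ(e₁ ϑt(i(e₂) s) r)], where [e₁ ϑt(i(e₂) s)] is [ϑ'(s)]. *)
Lemma relative_form_compat : ϑt ∘ m_ S ∘ (Id S ⊗ i) = ϑ ∘ m_ R ∘ (ϑ' ⊗ Id R).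
Proof. rewrite compat; unfold ϑ', relative_form; diag. Qed.

(** Compatibility and left linearity combine: [e₁ ϑt(i(e₂) s i(r)) = e₁ ϑ(ϑ'(i(e₂) s) r) = e₁ ϑ(e₂
    ϑ'(s) r)], and the snake identity of [R] yields [ϑ'(s) r]. *)
Lemma relative_form_right : ϑ' ∘ (m_ S ∘ (Id S ⊗ i)) = m_ R ∘ (ϑ' ⊗ Id R).
Proof.
pose proof relative_form_hom as ϑ'_hom.
transitivity ((Id R ⊗ (ϑt ∘ (m_ S ∘ (Id S ⊗ m_ S)))) ∘ (Id R ⊗ i ⊗ Id S ⊗ i) ∘
  (e ⊗ Id (S ⊠ R))); [unfold ϑ', relative_form; diag|]; rewrite <- mul_assoc.
string ((Id R ⊗ (ϑt ∘ m_ S ∘ (Id S ⊗ i))) ∘ (Id R ⊗ (m_ S ∘ (i ⊗ Id S)) ⊗ Id R) ∘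
  (e ⊗ Id (S ⊠ R))); rewrite relative_form_compat.
string ((Id R ⊗ (ϑ ∘ m_ R)) ∘ (Id R ⊗ (ϑ' ∘ (m_ S ∘ (i ⊗ Id S))) ⊗ Id R) ∘
  (e ⊗ Id (S ⊠ R))); rewrite relative_form_left.
string ((Id R ⊗ (ϑ ∘ (m_ R ∘ (m_ R ⊗ Id R)))) ∘ (e ⊗ Id R ⊗ Id R) ∘ (ϑ' ⊗ Id R)).
rewrite mul_assoc.
string ((Id R ⊗ (ϑ ∘ m_ R)) ∘ (e ⊗ Id R) ∘ (m_ R ∘ (ϑ' ⊗ Id R))).
rewrite (frobenius_snake_r Rpair); diag.
Qed.

(** The snake identity of [S] collapses [e₁ ϑt(i(e₂) et₁) ⊗ et₂] to [e₁ ⊗ i(e₂)]. Computations with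
    [et] thus become computations with [e]. *)
Lemma relative_form_transport : (ϑ' ⊗ Id S) ∘ et = (Id R ⊗ i) ∘ e.
Proof.
unfold ϑ', relative_form.
string ((Id R ⊗ (((ϑt ∘ m_ S) ⊗ Id S) ∘ (Id S ⊗ et))) ∘ (Id R ⊗ i) ∘ e).
rewrite (frobenius_snake_l Spair); diag.
Qed.

Variable a : mor C.
Hypothesis a_hom : a ∈ 𝟙 ⟶ R.
Hypothesis a_split : m_ R ∘ (Id R ⊗ (m_ R ∘ (a ⊗ Id R))) ∘ e = η_ R.

(* The Casimir element of [S] twisted by [a]; its image in [S ⊗_R S] is the
   Casimir element of the extension. *)
Definition twisted_casimir : mor C := (Id S ⊗ (m_ S ∘ ((i ∘ a) ⊗ Id S))) ∘ et.

Let w := twisted_casimir.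

Lemma twisted_casimir_hom : w ∈ 𝟙 ⟶ S ⊠ S.
Proof. unfold w, twisted_casimir; typed. Qed.

(** The twist multiplies the second leg on its left, while centrality concerns the left of the first
    leg and the right of the second; associativity lets them commute. *)
Lemma twisted_casimir_central :
  (m_ S ⊗ Id S) ∘ (Id S ⊗ w) = (Id S ⊗ m_ S) ∘ (w ⊗ Id S).
Proof.
pose proof Spair as (_ & _ & central & _); unfold w, twisted_casimir.
string ((Id S ⊗ (m_ S ∘ ((i ∘ a) ⊗ Id S))) ∘ ((m_ S ⊗ Id S) ∘ (Id S ⊗ et))).
rewrite central.
string ((Id S ⊗ (m_ S ∘ (Id S ⊗ m_ S))) ∘ (Id S ⊗ (i ∘ a) ⊗ Id (S ⊠ S)) ∘ (et ⊗ Id S)).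
rewrite <- mul_assoc; diag.
Qed.

Lemma twisted_casimir_transport :
  (ϑ' ⊗ Id S) ∘ w = (Id R ⊗ (i ∘ (m_ R ∘ (a ⊗ Id R)))) ∘ e.
Proof.
pose proof relative_form_hom as ϑ'_hom.
transitivity ((Id R ⊗ (m_ S ∘ ((i ∘ a) ⊗ Id S))) ∘ ((ϑ' ⊗ Id S) ∘ et));
  [unfold w, twisted_casimir; diag|rewrite relative_form_transport].
string ((Id R ⊗ ((m_ S ∘ (i ⊗ i)) ∘ (a ⊗ Id R))) ∘ e); rewrite <- i_mul; diag.
Qed.

(** After transport to [R] the left-hand side is [i(e₁ a e₂)], hence [i(1)] by the choice of [a]. *)
Lemma twisted_casimir_counit_l : m_ S ∘ ((i ∘ ϑ') ⊗ Id S) ∘ w = η_ S.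
Proof.
pose proof relative_form_hom as ϑ'_hom; pose proof twisted_casimir_hom as w_hom.
string (m_ S ∘ (i ⊗ Id S) ∘ ((ϑ' ⊗ Id S) ∘ w)); rewrite twisted_casimir_transport.
string (m_ S ∘ (i ⊗ i) ∘ (Id R ⊗ (m_ R ∘ (a ⊗ Id R))) ∘ e); rewrite <- i_mul.
string (i ∘ (m_ R ∘ (Id R ⊗ (m_ R ∘ (a ⊗ Id R))) ∘ e)); now rewrite a_split.
Qed.

(** Transport acts on the first leg, but here [ϑ'] sits on the second. The element
    [x = w₁ i(ϑ'(w₂))] is therefore tested against [ϑt], whose nondegeneracy gives [x = 1]. *)
Lemma twisted_casimir_counit_r : m_ S ∘ (Id S ⊗ (i ∘ ϑ')) ∘ w = η_ S.
Proof.
pose proof relative_form_hom as ϑ'_hom; pose proof twisted_casimir_hom as w_hom.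
set (x := m_ S ∘ _ ∘ w).
assert (x_hom : x ∈ 𝟙 ⟶ S).
{ unfold x; typed. }
(* [ϑt(s x) = ϑ(ϑ'(s w₁) ϑ'(w₂)) = ϑ(ϑ'(w₁) ϑ'(w₂ s))] by compatibility and centrality; transport
   and left linearity turn this into [ϑ(e₁ a e₂ ϑ'(s)) = ϑt(s)]. *)
assert (E : ϑt ∘ m_ S ∘ (Id S ⊗ x) = ϑt).
{ transitivity (ϑt ∘ (m_ S ∘ (Id S ⊗ m_ S)) ∘ (Id S ⊗ Id S ⊗ (i ∘ ϑ')) ∘ (Id S ⊗ w));
    [unfold x; diag|rewrite <- mul_assoc].
  string ((ϑt ∘ m_ S ∘ (Id S ⊗ i)) ∘ (m_ S ⊗ ϑ') ∘ (Id S ⊗ w)).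
  rewrite relative_form_compat.
  string (ϑ ∘ m_ R ∘ (ϑ' ⊗ ϑ') ∘ ((m_ S ⊗ Id S) ∘ (Id S ⊗ w))).
  rewrite twisted_casimir_central.
  string (ϑ ∘ m_ R ∘ (Id R ⊗ (ϑ' ∘ m_ S)) ∘ (((ϑ' ⊗ Id S) ∘ w) ⊗ Id S)).
  rewrite twisted_casimir_transport.
  string (ϑ ∘ m_ R ∘ (Id R ⊗ (ϑ' ∘ (m_ S ∘ (i ⊗ Id S)))) ∘
    (Id R ⊗ (m_ R ∘ (a ⊗ Id R)) ⊗ Id S) ∘ (e ⊗ Id S)).
  rewrite relative_form_left.
  string (ϑ ∘ (m_ R ∘ (Id R ⊗ m_ R)) ∘ (Id R ⊗ (m_ R ∘ (a ⊗ Id R)) ⊗ ϑ') ∘ (e ⊗ Id S)).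
  rewrite <- mul_assoc.
  string (ϑ ∘ m_ R ∘ ((m_ R ∘ (Id R ⊗ (m_ R ∘ (a ⊗ Id R))) ∘ e) ⊗ Id R) ∘ ϑ').
  rewrite a_split.
  string (ϑ ∘ (m_ R ∘ (η_ R ⊗ Id R)) ∘ ϑ'); rewrite mul_one_l.
  string (ϑ ∘ ϑ'); apply relative_form_counit. }
(* Nondegeneracy: [x = et₁ ϑt(et₂ x) = et₁ ϑt(et₂) = 1]. *)
transitivity (Id S ∘ x); [diag|rewrite <- (frobenius_snake_r Spair)].
string ((Id S ⊗ (ϑt ∘ m_ S ∘ (Id S ⊗ x))) ∘ et); rewrite E.
pose proof Spair as (_ & _ & _ & _ & counit); exact counit.
Qed.

End FromFrobeniusAlgebra.

(** * From a bimodule form [ϑ'] to a form and a Casimir insertion on [S] *)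

Section ToFrobeniusAlgebra.

Variable ϑ' : mor C.
Hypothesis ϑ'_hom : ϑ' ∈ S ⟶ R.
Hypothesis ϑ'_left : ϑ' ∘ (m_ S ∘ (i ⊗ Id S)) = m_ R ∘ (Id R ⊗ ϑ').
Hypothesis ϑ'_right : ϑ' ∘ (m_ S ∘ (Id S ⊗ i)) = m_ R ∘ (ϑ' ⊗ Id R).

(* [s ⊗ t ↦ s i(e₁) ⊗ i(e₂) t]; it factors through [S ⊗_R S] because [e] is
   central. *)
Definition casimir_insertion : mor C := (m_ S ⊗ m_ S) ∘ (Id S ⊗ ((i ⊗ i) ∘ e) ⊗ Id S).

Let W := casimir_insertion.

Lemma casimir_insertion_hom : W ∈ S ⊠ S ⟶ S ⊠ S.
Proof. unfold W, casimir_insertion; typed. Qed.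

Lemma casimir_insertion_balanced :
  W ∘ ((m_ S ∘ (Id S ⊗ i)) ⊗ Id S) = W ∘ (Id S ⊗ (m_ S ∘ (i ⊗ Id S))).
Proof.
pose proof Rpair as (_ & _ & central & _); unfold W, casimir_insertion.
string (((m_ S ∘ (m_ S ⊗ Id S)) ⊗ m_ S) ∘ (Id S ⊗ i ⊗ i ⊗ i ⊗ Id S) ∘
  (Id S ⊗ Id R ⊗ e ⊗ Id S)); rewrite mul_assoc.
string ((m_ S ⊗ m_ S) ∘ (Id S ⊗ (m_ S ∘ (i ⊗ i)) ⊗ i ⊗ Id S) ∘
  (Id S ⊗ Id R ⊗ e ⊗ Id S)); rewrite <- i_mul.
string ((m_ S ⊗ m_ S) ∘ (Id S ⊗ i ⊗ i ⊗ Id S) ∘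
  (Id S ⊗ ((m_ R ⊗ Id R) ∘ (Id R ⊗ e)) ⊗ Id S)); rewrite central.
string ((m_ S ⊗ m_ S) ∘ (Id S ⊗ i ⊗ (i ∘ m_ R) ⊗ Id S) ∘
  (Id S ⊗ e ⊗ Id R ⊗ Id S)); rewrite i_mul.
string ((m_ S ⊗ (m_ S ∘ (m_ S ⊗ Id S))) ∘ (Id S ⊗ i ⊗ i ⊗ i ⊗ Id S) ∘
  (Id S ⊗ e ⊗ Id R ⊗ Id S)); rewrite mul_assoc; diag.
Qed.

(** [W] multiplies only on the inner sides of the two legs, so outer multiplication passes through
    by associativity. Together with its mirror image this makes the map induced on [S ⊗_R S]
    bilinear over [S]. *)
Lemma casimir_insertion_left :
  (m_ S ⊗ Id S) ∘ (Id S ⊗ W) = W ∘ (m_ S ⊗ Id S).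
Proof.
unfold W, casimir_insertion.
string (((m_ S ∘ (Id S ⊗ m_ S)) ⊗ m_ S) ∘ (Id S ⊗ Id S ⊗ ((i ⊗ i) ∘ e) ⊗ Id S)).
rewrite <- mul_assoc; diag.
Qed.

Lemma casimir_insertion_right :
  (Id S ⊗ m_ S) ∘ (W ⊗ Id S) = W ∘ (Id S ⊗ m_ S).
Proof.
unfold W, casimir_insertion.
string ((m_ S ⊗ (m_ S ∘ (m_ S ⊗ Id S))) ∘ (Id S ⊗ ((i ⊗ i) ∘ e) ⊗ Id S ⊗ Id S)).
rewrite mul_assoc; diag.
Qed.

(** [s i(e₁) ϑ(ϑ'(i(e₂) t)) = s i(e₁) ϑ(e₂ ϑ'(t)) = s i(ϑ'(t))]: the form on [S] reproduces the
    expression in the right counit axiom of the extension. *)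
Lemma casimir_insertion_counit_r :
  (Id S ⊗ (ϑ ∘ ϑ')) ∘ W = (m_ S ∘ (Id S ⊗ i)) ∘ (Id S ⊗ ϑ').
Proof.
unfold W, casimir_insertion.
string ((m_ S ⊗ (ϑ ∘ (ϑ' ∘ (m_ S ∘ (i ⊗ Id S))))) ∘ (Id S ⊗ i ⊗ Id R ⊗ Id S) ∘
  (Id S ⊗ e ⊗ Id S)); rewrite ϑ'_left.
string ((m_ S ∘ (Id S ⊗ i)) ∘ (Id S ⊗ ((Id R ⊗ (ϑ ∘ m_ R)) ∘ (e ⊗ Id R))) ∘
  (Id S ⊗ ϑ')); rewrite (frobenius_snake_r Rpair); diag.
Qed.

Lemma casimir_insertion_counit_l :
  ((ϑ ∘ ϑ') ⊗ Id S) ∘ W = (m_ S ∘ (i ⊗ Id S)) ∘ (ϑ' ⊗ Id S).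
Proof.
unfold W, casimir_insertion.
string (((ϑ ∘ (ϑ' ∘ (m_ S ∘ (Id S ⊗ i)))) ⊗ m_ S) ∘ (Id S ⊗ Id R ⊗ i ⊗ Id S) ∘
  (Id S ⊗ e ⊗ Id S)); rewrite ϑ'_right.
string ((m_ S ∘ (i ⊗ Id S)) ∘ ((((ϑ ∘ m_ R) ⊗ Id R) ∘ (Id R ⊗ e)) ⊗ Id S) ∘
  (ϑ' ⊗ Id S)); rewrite (frobenius_snake_l Rpair); diag.
Qed.

(** Both sides are [ϑ(ϑ'(s) r)]: the left one by right linearity, the right one by left linearity
    and the snake identity of [R]. *)
Lemma bimodule_form_compat : ϑ ∘ ϑ' ∘ m_ S ∘ (Id S ⊗ i) =
  ϑ ∘ m_ R ∘ (Id R ⊗ (ϑ ∘ ϑ' ∘ m_ S ∘ (i ⊗ Id S)) ⊗ Id R) ∘ (e ⊗ Id (S ⊠ R)).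
Proof.
string (ϑ ∘ (ϑ' ∘ (m_ S ∘ (Id S ⊗ i)))); rewrite ϑ'_right; symmetry.
string (ϑ ∘ m_ R ∘ (Id R ⊗ (ϑ ∘ (ϑ' ∘ (m_ S ∘ (i ⊗ Id S)))) ⊗ Id R) ∘
  (e ⊗ Id (S ⊠ R))); rewrite ϑ'_left.
string (ϑ ∘ m_ R ∘ (((Id R ⊗ (ϑ ∘ m_ R)) ∘ (e ⊗ Id R)) ⊗ Id R) ∘ (ϑ' ⊗ Id R)).
rewrite (frobenius_snake_r Rpair); diag.
Qed.

End ToFrobeniusAlgebra.

End FrobeniusExtension.

(** * Coequalizers and the tensor product over an algebra *)

Section TensorOverAlgebra.

Variable C : StrictMonoidalCategory.
Hypothesis Hcoeq : has_coequalizers C.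

Lemma coequalizer_epi (f g p : mor C) (Z : ob C) (k k' : mor C) :
  is_coequalizer f g p -> k ∈ cod p ⟶ Z -> k' ∈ cod p ⟶ Z ->
  k ∘ p = k' ∘ p -> k = k'.
Proof.
intros ([pd pc] & dp & ep & U) [dk ck] [dk' ck'] E.
destruct (U (k ∘ p)) as (k0 & _ & uniq).
- now rewrite dom_comp.
- rewrite <- !comp_assoc by congruence; now rewrite ep.
- transitivity k0; [symmetry|]; apply uniq; unfold hom; rewrite cod_comp; intuition congruence.
Qed.

Lemma coequalizer_desc (f g p : mor C) (X Z : ob C) (h : mor C) :
  is_coequalizer f g p -> p ∈ X ⟶ cod p -> h ∈ X ⟶ Z -> h ∘ f = h ∘ g ->
  desc p h ∈ cod p ⟶ Z /\ desc p h ∘ p = h.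
Proof.
intros Hp [dp _] [dh <-] E; apply (desc_spec Hp); [|exact E].
destruct Hp as (_ & d & _); congruence.
Qed.

Lemma inv_counit (f : mor C) (X Y : ob C) (t x : mor C) :
  is_iso f -> f ∈ X ⟶ Y -> t ∈ 𝟙 ⟶ X -> x ∈ 𝟙 ⟶ Y ->
  (t = inv f ∘ x <-> f ∘ t = x).
Proof.
intros Hf [df cf] Ht Hx; destruct (inv_spec Hf) as (H & E1 & E2).
rewrite df, cf in *; pose proof (conj df cf : f ∈ X ⟶ Y) as Hf'.
split; [intros -> | intros <-].
- now rewrite (hom_assoc Hx H Hf'), E2, (id_l Hx).
- now rewrite (hom_assoc Ht Hf' H), E1, (id_l Ht).
Qed.

Section Projection.

Variables (R : Algebra C) (X Y : ob C) (ν μ : mor C).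
Hypothesis ν_hom : ν ∈ X ⊠ R ⟶ X.
Hypothesis μ_hom : μ ∈ R ⊠ Y ⟶ Y.

Lemma q_coequalizer : is_coequalizer (ν ⊗ Id Y) (Id X ⊗ μ) (q X ν Y μ).
Proof.
apply coeq_spec; [exact Hcoeq|].
assert (H1 : ν ⊗ Id Y ∈ X ⊠ R ⊠ Y ⟶ X ⊠ Y) by typed.
assert (H2 : Id X ⊗ μ ∈ X ⊠ R ⊠ Y ⟶ X ⊠ Y) by typed.
destruct H1, H2; split; congruence.
Qed.

Lemma q_hom : q X ν Y μ ∈ X ⊠ Y ⟶ cod (q X ν Y μ).
Proof.
split; [|reflexivity]; destruct q_coequalizer as (_ & -> & _).
assert (H : ν ⊗ Id Y ∈ X ⊠ R ⊠ Y ⟶ X ⊠ Y) by typed; apply H.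
Qed.

Lemma q_balanced : q X ν Y μ ∘ (ν ⊗ Id Y) = q X ν Y μ ∘ (Id X ⊗ μ).
Proof. apply q_coequalizer. Qed.

End Projection.

Lemma Upsilon_spec (R : Algebra C) (X : ob C) (ν : mor C) :
  is_right_module R X ν ->
  Upsilon R X ν ∈ cod (q X ν R (m_ R)) ⟶ X /\
  Upsilon R X ν ∘ q X ν R (m_ R) = ν /\ is_iso (Upsilon R X ν).
Proof.
intros (ν_hom & assoc & unital).
pose proof (q_coequalizer ν_hom (mul_hom R)) as Hq.
pose proof (q_hom ν_hom (mul_hom R)) as q_hom.
pose proof (q_balanced ν_hom (mul_hom R)) as balanced.
destruct (coequalizer_desc Hq q_hom ν_hom assoc) as [U_hom U_q].
fold (Upsilon R X ν) in U_hom, U_q; repeat split; [apply U_hom..|exact U_q|].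
set (p := q X ν R (m_ R)) in *.
(* The inverse is [x ↦ x ⊗_R 1]: balancing turns [x r ⊗_R 1] into [x ⊗_R r]. *)
assert (V_hom : p ∘ (Id X ⊗ η_ R) ∈ X ⟶ cod p) by typed.
exists (p ∘ (Id X ⊗ η_ R)); destruct U_hom as [d c]; unfold is_inverse; rewrite d, c.
pose proof (conj d c : Upsilon R X ν ∈ cod p ⟶ X) as U_hom.
repeat split; [apply V_hom..| |].
- apply (coequalizer_epi (Z := cod p) Hq); [typed | typed |].
  string (p ∘ (Id X ⊗ η_ R) ∘ (Upsilon R X ν ∘ p)); rewrite U_q.
  string (p ∘ (ν ⊗ Id R) ∘ (Id X ⊗ Id R ⊗ η_ R)); rewrite balanced.
  string (p ∘ (Id X ⊗ (m_ R ∘ (Id R ⊗ η_ R)))); rewrite mul_one_r; diag.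
- string (Upsilon R X ν ∘ p ∘ (Id X ⊗ η_ R)); now rewrite U_q.
Qed.

Lemma Upsilon'_spec (R : Algebra C) (Y : ob C) (μ : mor C) :
  is_left_module R Y μ ->
  Upsilon' R Y μ ∈ cod (q R (m_ R) Y μ) ⟶ Y /\
  Upsilon' R Y μ ∘ q R (m_ R) Y μ = μ /\ is_iso (Upsilon' R Y μ).
Proof.
intros (μ_hom & assoc & unital).
pose proof (q_coequalizer (mul_hom R) μ_hom) as Hq.
pose proof (q_hom (mul_hom R) μ_hom) as q_hom.
pose proof (q_balanced (mul_hom R) μ_hom) as balanced.
destruct (coequalizer_desc Hq q_hom μ_hom (eq_sym assoc)) as [U_hom U_q].
fold (Upsilon' R Y μ) in U_hom, U_q; repeat split; [apply U_hom..|exact U_q|].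
set (p := q R (m_ R) Y μ) in *.
assert (V_hom : p ∘ (η_ R ⊗ Id Y) ∈ Y ⟶ cod p) by typed.
exists (p ∘ (η_ R ⊗ Id Y)); destruct U_hom as [d c]; unfold is_inverse; rewrite d, c.
pose proof (conj d c : Upsilon' R Y μ ∈ cod p ⟶ Y) as U_hom.
repeat split; [apply V_hom..| |].
- apply (coequalizer_epi (Z := cod p) Hq); [typed | typed |].
  string (p ∘ (η_ R ⊗ Id Y) ∘ (Upsilon' R Y μ ∘ p)); rewrite U_q.
  string (p ∘ (Id R ⊗ μ) ∘ (η_ R ⊗ Id R ⊗ Id Y)); rewrite <- balanced.
  string (p ∘ ((m_ R ∘ (η_ R ⊗ Id R)) ⊗ Id Y)); rewrite mul_one_l; diag.
- string (Upsilon' R Y μ ∘ p ∘ (η_ R ⊗ Id Y)); now rewrite U_q.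
Qed.

(** The composite of [tilde] with [Upsilon] is the map [x ⊗_R y ↦ x f(y)]. Through it a counit axiom
    stated with the inverse of [Upsilon] becomes an equation that can be checked on [X ⊠ Y]. *)
Lemma tilde_Upsilon (R : Algebra C) (X Y : ob C) (ν μ f : mor C) :
  is_right_module R X ν -> μ ∈ R ⊠ Y ⟶ Y -> f ∈ Y ⟶ R ->
  f ∘ μ = m_ R ∘ (Id R ⊗ f) ->
  exists U, U ∈ cod (q X ν Y μ) ⟶ X /\ U ∘ q X ν Y μ = ν ∘ (Id X ⊗ f) /\
    forall t x, t ∈ 𝟙 ⟶ cod (q X ν Y μ) -> x ∈ 𝟙 ⟶ X ->
      (tilde X ν Y μ R (m_ R) f ∘ t = inv (Upsilon R X ν) ∘ x <-> U ∘ t = x).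
Proof.
intros Hν μ_hom f_hom linear; pose proof Hν as (ν_hom & _).
destruct (Upsilon_spec Hν) as (U_hom & U_q & U_iso).
pose proof (q_hom ν_hom μ_hom) as q_hom1.
pose proof (q_hom ν_hom (mul_hom R)) as q_hom2.
assert (T : tilde X ν Y μ R (m_ R) f ∈ cod (q X ν Y μ) ⟶ cod (q X ν R (m_ R)) /\
  tilde X ν Y μ R (m_ R) f ∘ q X ν Y μ = q X ν R (m_ R) ∘ (Id X ⊗ f)).
{ apply (coequalizer_desc (q_coequalizer ν_hom μ_hom) q_hom1); [typed|].
  string (q X ν R (m_ R) ∘ (ν ⊗ Id R) ∘ (Id X ⊗ Id R ⊗ f)).
  rewrite (q_balanced ν_hom (mul_hom R)).
  string (q X ν R (m_ R) ∘ (Id X ⊗ (m_ R ∘ (Id R ⊗ f)))); rewrite <- linear; diag. }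
destruct T as [T_hom T_q].
set (T := tilde X ν Y μ R (m_ R) f) in *; set (p := q X ν Y μ) in *.
set (U := Upsilon R X ν) in *.
exists (U ∘ T); repeat split; [apply (hom_comp T_hom U_hom)..| | | ].
- string (U ∘ (T ∘ p)); rewrite T_q.
  string (U ∘ q X ν R (m_ R) ∘ (Id X ⊗ f)); now rewrite U_q.
- intros E; apply (inv_counit U_iso U_hom) in E; [|typed|assumption].
  rewrite <- E; diag.
- intros E; apply (inv_counit U_iso U_hom); [typed|assumption|].
  rewrite <- E; diag.
Qed.

Lemma hat_Upsilon (R : Algebra C) (X Y : ob C) (ν μ f : mor C) :
  is_left_module R Y μ -> ν ∈ X ⊠ R ⟶ X -> f ∈ X ⟶ R ->
  f ∘ ν = m_ R ∘ (f ⊗ Id R) ->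
  exists U, U ∈ cod (q X ν Y μ) ⟶ Y /\ U ∘ q X ν Y μ = μ ∘ (f ⊗ Id Y) /\
    forall t x, t ∈ 𝟙 ⟶ cod (q X ν Y μ) -> x ∈ 𝟙 ⟶ Y ->
      (hat X ν R (m_ R) Y μ f ∘ t = inv (Upsilon' R Y μ) ∘ x <-> U ∘ t = x).
Proof.
intros Hμ ν_hom f_hom linear; pose proof Hμ as (μ_hom & _).
destruct (Upsilon'_spec Hμ) as (U_hom & U_q & U_iso).
pose proof (q_hom ν_hom μ_hom) as q_hom1.
pose proof (q_hom (mul_hom R) μ_hom) as q_hom2.
assert (T : hat X ν R (m_ R) Y μ f ∈ cod (q X ν Y μ) ⟶ cod (q R (m_ R) Y μ) /\
  hat X ν R (m_ R) Y μ f ∘ q X ν Y μ = q R (m_ R) Y μ ∘ (f ⊗ Id Y)).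
{ apply (coequalizer_desc (q_coequalizer ν_hom μ_hom) q_hom1); [typed|].
  symmetry; string (q R (m_ R) Y μ ∘ (Id R ⊗ μ) ∘ (f ⊗ Id R ⊗ Id Y)).
  rewrite <- (q_balanced (mul_hom R) μ_hom).
  string (q R (m_ R) Y μ ∘ ((m_ R ∘ (f ⊗ Id R)) ⊗ Id Y)); rewrite <- linear; diag. }
destruct T as [T_hom T_q].
set (T := hat X ν R (m_ R) Y μ f) in *; set (p := q X ν Y μ) in *.
set (U := Upsilon' R Y μ) in *.
exists (U ∘ T); repeat split; [apply (hom_comp T_hom U_hom)..| | | ].
- string (U ∘ (T ∘ p)); rewrite T_q.
  string (U ∘ q R (m_ R) Y μ ∘ (f ⊗ Id Y)); now rewrite U_q.
- intros E; apply (inv_counit U_iso U_hom) in E; [|typed|assumption].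
  rewrite <- E; diag.
- intros E; apply (inv_counit U_iso U_hom); [typed|assumption|].
  rewrite <- E; diag.
Qed.

(** * Restriction of scalars along [i] and the [S]-actions on [S ⊗_R S] *)

Section Restriction.

Variables (R S : Algebra C) (i : mor C).
Hypothesis Hi : algebra_morphism R S i.

Let i_hom : i ∈ R ⟶ S := proj1 Hi.

Lemma res_right_module : is_right_module R S (res_right S i).
Proof.
pose proof Hi as (_ & i_mul & i_one); unfold res_right; split; [typed|split].
- string (m_ S ∘ (m_ S ⊗ Id S) ∘ (Id S ⊗ i ⊗ i)); rewrite mul_assoc.
  string (m_ S ∘ (Id S ⊗ (m_ S ∘ (i ⊗ i)))); rewrite <- i_mul; diag.
- string (m_ S ∘ (Id S ⊗ (i ∘ η_ R))); rewrite i_one; apply mul_one_r.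
Qed.

Lemma res_left_module : is_left_module R S (res_left S i).
Proof.
pose proof Hi as (_ & i_mul & i_one); unfold res_left; split; [typed|split].
- string (m_ S ∘ (Id S ⊗ m_ S) ∘ (i ⊗ i ⊗ Id S)); rewrite <- mul_assoc.
  string (m_ S ∘ ((m_ S ∘ (i ⊗ i)) ⊗ Id S)); rewrite <- i_mul; diag.
- string (m_ S ∘ ((i ∘ η_ R) ⊗ Id S)); rewrite i_one; apply mul_one_l.
Qed.

Lemma qSS_coequalizer :
  is_coequalizer (res_right S i ⊗ Id S) (Id S ⊗ res_left S i) (qSS S i).
Proof. apply (@q_coequalizer R); [apply res_right_module | apply res_left_module]. Qed.

Lemma qSS_hom : qSS S i ∈ S ⊠ S ⟶ cod (qSS S i).
Proof. apply (@q_hom R); [apply res_right_module | apply res_left_module]. Qed.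

Hypothesis S_coflat : coflat S.

(** Coflatness keeps [Id S ⊗ qSS] a coequalizer, and associativity reduces the descent condition to
    the balancing of [qSS]. *)
Lemma mu_SRS_spec : mu_SRS S i ∈ S ⊠ cod (qSS S i) ⟶ cod (qSS S i) /\
  mu_SRS S i ∘ (Id S ⊗ qSS S i) = qSS S i ∘ (m_ S ⊗ Id S).
Proof.
pose proof qSS_hom as q_hom.
destruct (S_coflat qSS_coequalizer) as [Hq _].
assert (Sq_hom : Id S ⊗ qSS S i ∈ S ⊠ S ⊠ S ⟶ S ⊠ cod (qSS S i)) by typed.
(* [desc] is typed by the codomain of [Id S ⊗ qSS], so [S ⊠ cod qSS] is rewritten to that form. *)
destruct Sq_hom as [d c]; unfold mu_SRS; rewrite <- c.
apply (coequalizer_desc (X := S ⊠ S ⊠ S) Hq); [now split|typed|].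
unfold res_right, res_left.
string (qSS S i ∘ ((m_ S ∘ (Id S ⊗ m_ S)) ⊗ Id S) ∘ (Id S ⊗ Id S ⊗ i ⊗ Id S)).
rewrite <- mul_assoc.
string (qSS S i ∘ ((m_ S ∘ (Id S ⊗ i)) ⊗ Id S) ∘ (m_ S ⊗ Id R ⊗ Id S)).
destruct qSS_coequalizer as (_ & _ & balanced & _); unfold res_right, res_left in balanced.
rewrite balanced; diag.
Qed.

Lemma nu_SRS_spec : nu_SRS S i ∈ cod (qSS S i) ⊠ S ⟶ cod (qSS S i) /\
  nu_SRS S i ∘ (qSS S i ⊗ Id S) = qSS S i ∘ (Id S ⊗ m_ S).
Proof.
pose proof qSS_hom as q_hom.
destruct (S_coflat qSS_coequalizer) as [_ Hq].
assert (qS_hom : qSS S i ⊗ Id S ∈ S ⊠ S ⊠ S ⟶ cod (qSS S i) ⊠ S) by typed.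
destruct qS_hom as [d c]; unfold nu_SRS; rewrite <- c.
apply (coequalizer_desc (X := S ⊠ S ⊠ S) Hq); [now split|typed|].
unfold res_right, res_left; symmetry.
string (qSS S i ∘ (Id S ⊗ (m_ S ∘ (m_ S ⊗ Id S))) ∘ (Id S ⊗ i ⊗ Id S ⊗ Id S)).
rewrite mul_assoc.
string (qSS S i ∘ (Id S ⊗ (m_ S ∘ (i ⊗ Id S))) ∘ (Id S ⊗ Id R ⊗ m_ S)).
destruct qSS_coequalizer as (_ & _ & balanced & _); unfold res_right, res_left in balanced.
rewrite <- balanced; diag.
Qed.

End Restriction.

End TensorOverAlgebra.

(** * Passage between the axioms over [S ⊗_R S] and those over [S ⊠ S] *)

Section Descent.

Variables (C : StrictMonoidalCategory) (R S : Algebra C) (i : mor C).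
Hypothesis Hcoeq : has_coequalizers C.
Hypothesis S_coflat : coflat S.
Hypothesis Hi : algebra_morphism R S i.

Let i_hom : i ∈ R ⟶ S := proj1 Hi.

Lemma frobenius_algebra_extension ϑ e ϑt et : frobenius_pair R ϑ e ->
  separable R -> frobenius_pair S ϑt et ->
  ϑt ∘ m_ S ∘ (Id S ⊗ i) =
    ϑ ∘ m_ R ∘ (Id R ⊗ (ϑt ∘ m_ S ∘ (i ⊗ Id S)) ⊗ Id R) ∘ (e ⊗ Id (S ⊠ R)) ->
  frobenius_extension R S i.
Proof.
intros Rpair Rsep Spair compat; pose proof Hi as (_ & i_mul & i_one).
destruct (separable_frobenius_element Rpair Rsep) as (a & a_hom & a_split).
pose proof (relative_form_hom i_hom Rpair Spair) as ϑ'_hom.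
pose proof (relative_form_left i_hom i_mul Rpair Spair) as left.
pose proof (relative_form_right i_hom i_mul Rpair Spair compat) as right.
pose proof (twisted_casimir_hom i_hom Spair a_hom) as w_hom.
pose proof (twisted_casimir_central i_hom Spair a_hom) as central.
pose proof (twisted_casimir_counit_l i_hom i_mul i_one Rpair Spair a_hom a_split) as counit_l.
pose proof (twisted_casimir_counit_r i_hom i_mul i_one Rpair Spair compat a_hom a_split)
  as counit_r.
set (ϑ' := relative_form R S i e ϑt) in *.
set (w := twisted_casimir S i et a) in *.
pose proof (qSS_hom Hcoeq Hi) as q_hom.
destruct (mu_SRS_spec Hcoeq Hi S_coflat) as [mu_hom mu_q].
destruct (nu_SRS_spec Hcoeq Hi S_coflat) as [nu_hom nu_q].
pose proof (res_right_module Hi) as ν_mod; pose proof (res_left_module Hi) as μ_mod.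
destruct (tilde_Upsilon Hcoeq ν_mod (proj1 μ_mod) ϑ'_hom left) as (U & U_hom & U_q & HU).
destruct (hat_Upsilon Hcoeq μ_mod (proj1 ν_mod) ϑ'_hom right) as (V & V_hom & V_q & HV).
fold (qSS S i) in U_hom, U_q, HU, V_hom, V_q, HV.
(* Each axiom is now the image under [qSS] of an identity already established for [w] in [S ⊠ S]. *)
exists ϑ', (qSS S i ∘ w); repeat split; [apply ϑ'_hom..|exact left|exact right| | | | |].
1,2: apply (hom_comp w_hom q_hom).
- string (mu_SRS S i ∘ (Id S ⊗ qSS S i) ∘ (Id S ⊗ w)); rewrite mu_q.
  string (qSS S i ∘ ((m_ S ⊗ Id S) ∘ (Id S ⊗ w))); rewrite central.
  string (qSS S i ∘ (Id S ⊗ m_ S) ∘ (w ⊗ Id S)); rewrite <- nu_q; diag.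
- apply HU; [typed | apply one_hom |].
  string (U ∘ qSS S i ∘ w); rewrite U_q, <- counit_r; unfold res_right; diag.
- apply HV; [typed | apply one_hom |].
  string (V ∘ qSS S i ∘ w); rewrite V_q, <- counit_l; unfold res_left; diag.
Qed.

(** [W] descends to a bilinear map [ψ] from [S ⊗_R S] to [S ⊠ S], and [ψ] carries [e'] to the
    Casimir element of [S]. This lifts [e'] without choosing representatives [s ⊗ t]. *)
Lemma frobenius_extension_algebra ϑ e : frobenius_pair R ϑ e ->
  frobenius_extension R S i -> exists ϑt et, frobenius_pair S ϑt et /\
  ϑt ∘ m_ S ∘ (Id S ⊗ i) =
    ϑ ∘ m_ R ∘ (Id R ⊗ (ϑt ∘ m_ S ∘ (i ⊗ Id S)) ⊗ Id R) ∘ (e ⊗ Id (S ⊠ R)).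
Proof.
intros Rpair (ϑ' & e' & (ϑ'_hom & left & right) & e'_hom & central & counit_r & counit_l).
pose proof Hi as (_ & i_mul & i_one).
pose proof (casimir_insertion_hom i_hom Rpair) as W_hom.
pose proof (casimir_insertion_balanced i_hom i_mul Rpair) as W_balanced.
pose proof (casimir_insertion_left i_hom Rpair) as W_left.
pose proof (casimir_insertion_right i_hom Rpair) as W_right.
pose proof (casimir_insertion_counit_l i_hom Rpair ϑ'_hom right) as W_counit_l.
pose proof (casimir_insertion_counit_r i_hom Rpair ϑ'_hom left) as W_counit_r.
pose proof (bimodule_form_compat i_hom Rpair ϑ'_hom left right) as compat.
set (W := casimir_insertion S i e) in *.
pose proof (qSS_hom Hcoeq Hi) as q_hom; pose proof (qSS_coequalizer Hcoeq Hi) as Hq.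
destruct (mu_SRS_spec Hcoeq Hi S_coflat) as [mu_hom mu_q].
destruct (nu_SRS_spec Hcoeq Hi S_coflat) as [nu_hom nu_q].
pose proof (res_right_module Hi) as ν_mod; pose proof (res_left_module Hi) as μ_mod.
destruct (tilde_Upsilon Hcoeq ν_mod (proj1 μ_mod) ϑ'_hom left) as (U & U_hom & U_q & HU).
destruct (hat_Upsilon Hcoeq μ_mod (proj1 ν_mod) ϑ'_hom right) as (V & V_hom & V_q & HV).
fold (qSS S i) in U_hom, U_q, HU, V_hom, V_q, HV.
apply (HU _ _ e'_hom (one_hom S)) in counit_r.
apply (HV _ _ e'_hom (one_hom S)) in counit_l.
destruct (coequalizer_desc Hq q_hom W_hom W_balanced) as [ψ_hom ψ_q].
set (ψ := desc (qSS S i) W) in *; set (p := qSS S i) in *.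
destruct Rpair as (ϑ_hom & _).
destruct (S_coflat Hq) as [Sq qS].
assert (Sp_hom : Id S ⊗ p ∈ S ⊠ S ⊠ S ⟶ S ⊠ cod p) by typed.
assert (pS_hom : p ⊗ Id S ∈ S ⊠ S ⊠ S ⟶ cod p ⊠ S) by typed.
(* Bilinearity is tested after [Id S ⊗ p], which is epi because [S] is coflat. *)
assert (ψ_left : (m_ S ⊗ Id S) ∘ (Id S ⊗ ψ) = ψ ∘ mu_SRS S i).
{ apply (coequalizer_epi (Z := S ⊠ S) Sq); [rewrite (proj2 Sp_hom); typed..|].
  string ((m_ S ⊗ Id S) ∘ (Id S ⊗ (ψ ∘ p))); rewrite ψ_q, W_left, <- ψ_q.
  string (ψ ∘ (p ∘ (m_ S ⊗ Id S))); rewrite <- mu_q; diag. }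
assert (ψ_right : (Id S ⊗ m_ S) ∘ (ψ ⊗ Id S) = ψ ∘ nu_SRS S i).
{ apply (coequalizer_epi (Z := S ⊠ S) qS); [rewrite (proj2 pS_hom); typed..|].
  string ((Id S ⊗ m_ S) ∘ ((ψ ∘ p) ⊗ Id S)); rewrite ψ_q, W_right, <- ψ_q.
  string (ψ ∘ (p ∘ (Id S ⊗ m_ S))); rewrite <- nu_q; diag. }
(* Both maps restrict along [p] to [s ⊗ t ↦ i(ϑ'(s)) t], so the counit law for [ψ ∘ e'] is exactly
   the one already known for [V]. *)
assert (ψ_counit_l : ((ϑ ∘ ϑ') ⊗ Id S) ∘ ψ = V).
{ apply (coequalizer_epi (Z := S : ob C) Hq); [typed | exact V_hom |].
  string (((ϑ ∘ ϑ') ⊗ Id S) ∘ (ψ ∘ p)); now rewrite ψ_q, W_counit_l, V_q. }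
assert (ψ_counit_r : (Id S ⊗ (ϑ ∘ ϑ')) ∘ ψ = U).
{ apply (coequalizer_epi (Z := S : ob C) Hq); [typed | exact U_hom |].
  string ((Id S ⊗ (ϑ ∘ ϑ')) ∘ (ψ ∘ p)); now rewrite ψ_q, W_counit_r, U_q. }
exists (ϑ ∘ ϑ'), (ψ ∘ e'); split; [|exact compat].
repeat split; [apply (hom_comp ϑ'_hom ϑ_hom)..|apply (hom_comp e'_hom ψ_hom)
  |apply (hom_comp e'_hom ψ_hom)| | | ].
- string (((m_ S ⊗ Id S) ∘ (Id S ⊗ ψ)) ∘ (Id S ⊗ e')); rewrite ψ_left.
  string (ψ ∘ (mu_SRS S i ∘ (Id S ⊗ e'))); rewrite central.
  string ((ψ ∘ nu_SRS S i) ∘ (e' ⊗ Id S)); rewrite <- ψ_right; diag.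
- string (((ϑ ∘ ϑ') ⊗ Id S) ∘ ψ ∘ e'); now rewrite ψ_counit_l.
- string ((Id S ⊗ (ϑ ∘ ϑ')) ∘ ψ ∘ e'); now rewrite ψ_counit_r.
Qed.

End Descent.

Theorem theorem5p10 (C : StrictMonoidalCategory)
  (Hcoeq : has_coequalizers C)
  (Hcoflat : forall X : ob C, coflat X)
  (Hrobust : forall (R : Algebra C) (Y : ob C) (μ : mor C),
     is_left_module R Y μ -> left_robust R Y μ)
  (R S : Algebra C) (i : mor C)
  (HRfrob : frobenius R) (HRsep : separable R)
  (Hi : algebra_morphism R S i) :
  frobenius_extension R S i <->
  frobenius S /\
  exists ϑ e ϑt et : mor C,
    frobenius_pair R ϑ e /\ frobenius_pair S ϑt et /\
    ϑt ∘ m_ S ∘ (Id S ⊗ i) =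
    ϑ ∘ m_ R ∘ (Id R ⊗ (ϑt ∘ m_ S ∘ (i ⊗ Id S)) ⊗ Id R) ∘ (e ⊗ Id (S ⊠ R)).
Proof.
split.
(* Any Frobenius pair of [R] serves here: the pair built on [S] is compatible with the one
   chosen. *)
- intros Hext; destruct HRfrob as (ϑ & e & Rpair).
  destruct (frobenius_extension_algebra Hcoeq (Hcoflat S) Hi Rpair Hext)
    as (ϑt & et & Spair & compat).
  split; [now exists ϑt, et|now exists ϑ, e, ϑt, et].
- intros [_ (ϑ & e & ϑt & et & Rpair & Spair & compat)].
  exact (frobenius_algebra_extension Hcoeq (Hcoflat S) Hi Rpair HRsep Spair compat).
Qed.
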